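(* Let $G$ be a (small) groupoid and let $R$ be a ring graded by $G$, with principal component $R_0=\bigoplus_{e\in \mathrm{ob}(G)}R_e$. If the $G$-grading of $R$ is right nondegenerate or left nondegenerate, then the commutant $C_R(Z(R_0))$ of the center of $R_0$ has the ideal intersection property in $R$; that is, $C_R(Z(R_0))\cap I\neq\{0\}$ for every nonzero two-sided ideal $I$ of $R$.
   Context: All rings are associative and unital with $1_R\neq 0$. For nonempty subsets $X,Y$ of a ring, $XY$ denotes the set of all finite sums of products $xy$ with $x\in X$, $y\in Y$. For a subset $S$ of a ring $R$, the commutant $C_R(S)$ is the set of elements of $R$ commuting with every element of $S$. The center is $Z(R)=C_R(R)$. Categories are small. Write $s\in G$ for a morphism $s$ of a category $G$, with domain $d(s)$ and codomain $c(s)$. $\mathrm{ob}(G)$ is the set of objects; objects are identified with their identity morphisms. $G^{(2)}$ is the set of pairs $(s,t)$ of morphisms with $d(s)=c(t)$ (so that $st$ is defined). A groupoid is a category in which all morphisms are isomorphisms. A ring $R$ is graded by $G$ if there are additive subgroups $R_s$ ($s\in G$) of $R$ with $R=\bigoplus_{s\in G}R_s$, $R_sR_t\subseteq R_{st}$ if $(s,t)\in G^{(2)}$, and $R_sR_t=\{0\}$ otherwise. The principal component is $R_0=\bigoplus_{e\in \mathrm{ob}(G)}R_e$ (which contains $1_R$ when $G$ is a groupoid). The grading is right nondegenerate (resp. left nondegenerate) if for each isomorphism $s\in G$ and each nonzero $x\in R_s$, the right (resp. left) $R_0$-ideal $xR_{s^{-1}}$ (resp. $R_{s^{-1}}x$)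 is nonzero. *)

(* Defs.v *)
From mathcomp Require Import all_boot all_algebra all_classical.

Set Implicit Arguments.
Unset Strict Implicit.
Unset Printing Implicit Defensive.

Import GRing.Theory.
Local Open Scope classical_set_scope.
Local Open Scope ring_scope.

(* Small categories, given by their sets of objects and of morphisms.
   [catcomp s t] stands for the composite st only when
   [catdom s = catcod t]; its values on other pairs are unconstrained.
   Objects embed injectively into morphisms through [catid], by [catdom_id].
   The [choiceType]s are required by the finitely supported sums of [fsbigop];
   classically every type carries such a structure. *)
Record category := Category {
  catob : choiceType;
  catmor : choiceType;
  catdom : catmor -> catob;
  catcod : catmor -> catob;
  catid : catob -> catmor;
  catcomp : catmor -> catmor -> catmor;
  catdom_id : forall e, catdom (catid e) = e;
  catcod_id : forall e, catcod (catid e) = e;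
  catdom_comp : forall s t, catdom s = catcod t ->
    catdom (catcomp s t) = catdom t;
  catcod_comp : forall s t, catdom s = catcod t ->
    catcod (catcomp s t) = catcod s;
  catcompA : forall s t u, catdom s = catcod t -> catdom t = catcod u ->
    catcomp s (catcomp t u) = catcomp (catcomp s t) u;
  catcomp_idl : forall s, catcomp (catid (catcod s)) s = s;
  catcomp_idr : forall s, catcomp s (catid (catdom s)) = s
}.

Definition is_inverse (G : category) (s t : catmor G) : Prop :=
  [/\ catdom s = catcod t, catdom t = catcod s,
      catcomp s t = catid (catcod s) & catcomp t s = catid (catdom s)].

Definition is_groupoid (G : category) : Prop :=
  forall s : catmor G, exists t, is_inverse s t.

Section RingSubsets.
Variable R : nzRingType.
Implicit Types A S X Y I : set R.

Definition prod_set X Y : set R :=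
  [set z | exists (n : nat) (x y : 'I_n -> R),
     [/\ forall i, X (x i), forall i, Y (y i) & z = \sum_(i < n) x i * y i]].

(* C_A(S), for a subring A of R *)
Definition commutant A S : set R :=
  [set x | A x /\ forall y, S y -> x * y = y * x].

(* Z(A), for a subring A of R *)
Definition center_of A : set R := commutant A A.

Definition two_sided_ideal I : Prop :=
  zmod_closed [in I] /\ forall a x, I x -> I (a * x) /\ I (x * a).

Definition ideal_intersection_property S : Prop :=
  forall I, two_sided_ideal I -> I <> [set 0] -> S `&` I <> [set 0].

Definition decomposition (J : choiceType) (V : J -> set R) (x : R)
    (f : J -> R) : Prop :=
  [/\ forall j, V j (f j), finite_set (f @^-1` [set~ 0])
    & x = \sum_(j \in [set: J]) f j].

Definition family_sum (J : choiceType) (V : J -> set R) : set R :=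
  [set x | exists f, decomposition V x f].

End RingSubsets.

Section Grading.
Variables (G : category) (R : nzRingType) (V : catmor G -> set R).

Record is_graded : Prop := IsGraded {
  graded_zmod : forall s, zmod_closed [in V s];
  graded_direct_sum : forall x, exists! f, decomposition V x f;
  graded_mul : forall s t, catdom s = catcod t ->
    prod_set (V s) (V t) `<=` V (catcomp s t);
  graded_mul0 : forall s t, catdom s <> catcod t ->
    prod_set (V s) (V t) = [set 0]
}.

Definition principal_component : set R :=
  family_sum (fun e : catob G => V (catid e)).

(* [s] ranges over the isomorphisms of [G], with inverse [t]. *)
Definition right_nondegenerate : Prop :=
  forall s t, is_inverse s t -> forall x, V s x -> x <> 0 ->
    prod_set [set x] (V t) <> [set 0].

Definition left_nondegenerate : Prop :=
  forall s t, is_inverse s t -> forall x, V s x -> x <> 0 ->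
    prod_set (V t) [set x] <> [set 0].

End Grading.

(* Main.v *)
Require Import Defs.
From mathcomp Require Import all_boot all_algebra all_classical.

(* Among the nonzero elements of an ideal I, induct on the size of the support.
   By nondegeneracy, multiplying x by a homogeneous element whose degree is
   inverse to some degree of x gives an element of I, with no larger support
   and with a nonzero component x_e at an object e. If this element does not
   commute with some z in Z(R_0), then z x - x z is a nonzero element of I
   whose support is strictly smaller, since z commutes with x_e. *)

Set Implicit Arguments.
Unset Strict Implicit.
Unset Printing Implicit Defensive.

Import GRing.Theory.
(* Corelib's ssrfun also exports a [catcomp]. *)
Local Notation catcomp := Defs.catcomp.
Local Open Scope classical_set_scope.
Local Open Scope ring_scope.

(** * Finitely supported sums over lists *)

Section FamilySums.
Variables (R : nzRingType) (J : choiceType).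
Implicit Types (V : J -> set R) (f g : J -> R).

Lemma fsum_seq f (S : seq J) : uniq S -> (forall j, j \notin S -> f j = 0) ->
  \sum_(j \in [set: J]) f j = \sum_(j <- S) f j.
Proof.
move=> uS f0; rewrite (@fsbigE _ _ _ _ _ S)// => [|j _]; last exact: f0.
by apply: eq_bigl => j; rewrite in_setT.
Qed.

(** The list [S] may exceed the support of [f]; this freedom allows two decompositions to be summed
    over a common list. *)
Lemma decompositionP V x f : decomposition V x f <->
  (forall j, V j (f j)) /\ exists S : seq J,
    [/\ uniq S, forall j, j \notin S -> f j = 0 & x = \sum_(j <- S) f j].
Proof.
split=> [[Vf /finite_seqP[S fS] ->]|[Vf [S [uS f0 ->]]]].
  have f0 j : j \notin undup S -> f j = 0.
    rewrite mem_undup => jS; apply: contrapT => fj.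
    by move: jS; have : (f @^-1` [set~ 0]) j by []; rewrite fS /= => ->.
  split=> //; exists (undup S).
  by split; rewrite ?undup_uniq// (fsum_seq (undup_uniq S)).
split=> //; last by rewrite (fsum_seq uS).
apply: sub_finite_set (finite_seq S) => j /= fj.
by apply: contrapT => /negP/f0.
Qed.

End FamilySums.

Lemma zmod_closed_set (U : zmodType) (A : set U) : zmod_closed [in A] ->
  [/\ A 0, forall x y, A x -> A y -> A (x - y)
    & forall x y, A x -> A y -> A (x + y)].
Proof.
move=> [/set_mem A0 zmodB].
have AB x y : A x -> A y -> A (x - y).
  by move=> Ax Ay; apply/set_mem/zmodB; apply/mem_set.
split=> // x y Ax Ay; rewrite -[y]opprK; apply: (AB) => //.
by rewrite -sub0r; exact: AB.
Qed.

Lemma decompositionD (R : nzRingType) (J : choiceType) (V : J -> set R) x y f g :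
  (forall j, zmod_closed [in V j]) ->
  decomposition V x f -> decomposition V y g ->
  decomposition V (x + y) (f \+ g).
Proof.
move=> /(_ _)/zmod_closed_set VZ.
move=> /decompositionP[Vf [S [uS f0 ->]]] /decompositionP[Vg [T [uT g0 ->]]].
apply/decompositionP; split=> [j|]; first by have [_ _] := VZ j; apply.
have fST j : j \notin undup (S ++ T) -> f j = 0 /\ g j = 0.
  by rewrite mem_undup mem_cat negb_or => /andP[/f0 -> /g0 ->].
exists (undup (S ++ T)).
split=> [|j /fST[/= -> ->]|]; rewrite ?undup_uniq ?addr0//.
rewrite -(fsum_seq uS)// -(fsum_seq uT)// big_split/=.
by rewrite -!(fsum_seq (undup_uniq _))// => j /fST[].
Qed.

(** The index type stays general because this serves both for the morphisms indexing $R$ and for the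
    objects indexing $R_0$. *)
Lemma decomposition1 (R : nzRingType) (J : choiceType) (V : J -> set R) j x :
  (forall i, V i 0) -> V j x ->
  decomposition V x (fun i => if i == j then x else 0).
Proof.
move=> V0 Vx; apply/decompositionP; split=> [i|]; first by case: eqP => [->|].
exists [:: j]; split=> // [i|]; rewrite ?big_seq1 ?eqxx// inE.
by move/negbTE->.
Qed.

(** * Homogeneous components and their behaviour under products *)

Section Components.
Variables (G : category) (R : nzRingType) (V : catmor G -> set R).
Hypothesis HV : is_graded V.
Local Notation R0 := (principal_component V).

Let VZ s := zmod_closed_set (graded_zmod HV s).

Lemma graded0 s : V s 0. Proof. by case: (VZ s). Qed.

Lemma gradedD s x y : V s x -> V s y -> V s (x + y).
Proof. by case: (VZ s) => _ _; apply. Qed.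

Lemma gradedM s t x y : V s x -> V t y -> catdom s = catcod t ->
  V (catcomp s t) (x * y).
Proof.
move=> Vx Vy st; apply: (graded_mul HV st).
by exists 1%N, (fun=> x), (fun=> y); rewrite big_ord1.
Qed.

Lemma gradedM0 s t x y : V s x -> V t y -> catdom s <> catcod t -> x * y = 0.
Proof.
move=> Vx Vy st; have : prod_set (V s) (V t) (x * y).
  by exists 1%N, (fun=> x), (fun=> y); rewrite big_ord1.
by rewrite (graded_mul0 HV st).
Qed.

Definition component (x : R) : catmor G -> R :=
  sval (cid (graded_direct_sum HV x)).

Lemma component_decomposition x : decomposition V x (component x).
Proof. by have [] := svalP (cid (graded_direct_sum HV x)). Qed.

(** Directness of the sum: to compute components it suffices to exhibit one decomposition. *)
Lemma decomposition_component x f : decomposition V x f -> component x = f.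
Proof. by have [_ gu] := svalP (cid (graded_direct_sum HV x)); move/gu. Qed.

Lemma component_graded x s : V s (component x s).
Proof. by case: (component_decomposition x). Qed.

Lemma componentD x y s : component (x + y) s = component x s + component y s.
Proof.
rewrite (@decomposition_component _ (component x \+ component y))//.
by apply: decompositionD (graded_zmod HV) _ _; exact: component_decomposition.
Qed.

Lemma component_hom s x t : V s x -> component x t = if t == s then x else 0.
Proof.
move=> Vx.
by rewrite (decomposition_component (decomposition1 graded0 Vx)).
Qed.

Lemma component0 s : component 0 s = 0.
Proof. by rewrite (component_hom _ (graded0 s)) eqxx. Qed.

Lemma componentN x s : component (- x) s = - component x s.
Proof.
by apply: (addrI (component x s)); rewrite -componentD !subrr component0.
Qed.

Lemma componentB x y s : component (x - y) s = component x s - component y s.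
Proof. by rewrite componentD componentN. Qed.

Lemma component_support x : exists S : seq (catmor G),
  forall s, s \notin S -> component x s = 0.
Proof.
by have /decompositionP[_ [S []]] := component_decomposition x; exists S.
Qed.

Lemma component_neq0 x : x <> 0 -> exists s, component x s <> 0.
Proof.
move=> x0; apply: contrapT => /forallNP cx0; apply: x0.
have /decompositionP[_ [S [_ _ ->]]] := component_decomposition x.
by apply: big1 => s _; apply: contrapT (cx0 s).
Qed.

Lemma homogeneous_ind (P : R -> Prop) :
  P 0 -> (forall x y, P x -> P y -> P (x + y)) ->
  (forall s x, V s x -> P x) -> forall x, P x.
Proof.
move=> P0 PD PV x.
have /decompositionP[Vx [S [_ _ ->]]] := component_decomposition x.
by elim/big_ind: _ => // s _; exact: PV (Vx s).
Qed.

(** Right multiplication by [y] moves degree $t$ to $ts^{-1}$, injectively with inverse $u\mapsto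
    us$, so at most one component of [x] reaches degree [u]. The test on [catdom u] says that $us$
    is defined; otherwise [catcomp u s] has no meaning. *)
Lemma component_mulr s s' y x u : is_inverse s s' -> V s' y ->
  component (x * y) u =
    if catdom u == catdom s' then component x (catcomp u s) * y else 0.
Proof.
move=> [ds cs ss' s's] Vy; elim/homogeneous_ind: x => [|x1 x2 IH1 IH2|t x Vx].
- by rewrite mul0r !component0 mul0r if_same.
- by rewrite mulrDl !componentD IH1 IH2; case: ifP; rewrite ?addr0// mulrDl.
rewrite (component_hom _ Vx).
have [dt|dt] := pselect (catdom t = catcod s').
  rewrite (component_hom _ (gradedM Vx Vy dt)).
  have [->|ut] := eqVneq u (catcomp t s').
    by rewrite catdom_comp// eqxx -catcompA// s's ds -dt catcomp_idr eqxx.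
  (* If $us=t$, then $u=uss^{-1}=ts^{-1}$, contrary to [ut]. *)
  case: eqP => // du; case: eqP => [ust|]; rewrite ?mul0r//.
  move: ut; rewrite -ust -catcompA ?du// ss' -cs -du catcomp_idr.
  by rewrite eqxx.
rewrite (gradedM0 Vx Vy dt) component0; case: eqP => // du.
(* Here $us=t$ would force $d(t)=d(s)=c(s^{-1})$, against [dt]. *)
case: eqP => [ust|]; rewrite ?mul0r//.
by case: dt; rewrite -ust catdom_comp// du.
Qed.

(** Mirror image of [component_mulr]: degrees move by $t\mapsto s^{-1}t$, with inverse $u\mapsto
    su$. *)
Lemma component_mull s s' y x u : is_inverse s s' -> V s' y ->
  component (y * x) u =
    if catcod u == catcod s' then y * component x (catcomp s u) else 0.
Proof.
move=> [ds cs ss' s's] Vy; elim/homogeneous_ind: x => [|x1 x2 IH1 IH2|t x Vx].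
- by rewrite mulr0 !component0 mulr0 if_same.
- by rewrite mulrDr !componentD IH1 IH2; case: ifP; rewrite ?addr0// mulrDr.
rewrite (component_hom _ Vx).
have [dt|dt] := pselect (catdom s' = catcod t).
  rewrite (component_hom _ (gradedM Vy Vx dt)).
  have [->|ut] := eqVneq u (catcomp s' t).
    by rewrite catcod_comp// eqxx catcompA// ss' -cs dt catcomp_idl eqxx.
  case: eqP => // du; case: eqP => [ust|]; rewrite ?mulr0//.
  move: ut; rewrite -ust catcompA ?du// s's ds -du catcomp_idl.
  by rewrite eqxx.
rewrite (gradedM0 Vy Vx dt) component0; case: eqP => // du.
case: eqP => [ust|]; rewrite ?mulr0//.
by case: dt; rewrite -ust catcod_comp// du.
Qed.

(** Of the components of [z], only the one at $c(s)$ acts from the left and only the one at $d(s)$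
    from the right, and these identities do not change the degree. *)
Lemma principal_gradedM z s x : R0 z -> V s x -> V s (z * x) /\ V s (x * z).
Proof.
move=> [f /decompositionP[Vf [S [_ _ ->]]]] Vx; rewrite mulr_suml mulr_sumr.
split; elim/big_ind: _ => [|? ?|e _]; try exact: graded0; try exact: gradedD.
- have [es|es] := pselect (e = catcod s).
    by have := gradedM (Vf e) Vx; rewrite catdom_id es catcomp_idl; apply.
  by rewrite (gradedM0 (Vf e) Vx) ?catdom_id//; exact: graded0.
- have [es|es] := pselect (e = catdom s).
    by have := gradedM Vx (Vf e); rewrite catcod_id es catcomp_idr; apply.
  rewrite (gradedM0 Vx (Vf e)) ?catcod_id//; first exact: graded0.
  exact/nesym.
Qed.

(** Since $R_0$ preserves every degree, taking a component is $R_0$-linear on both sides. *)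
Lemma component_principalM z x s : R0 z ->
  component (z * x) s = z * component x s /\
  component (x * z) s = component x s * z.
Proof.
move=> R0z; elim/homogeneous_ind: x => [|x y [IHx1 IHx2] [IHy1 IHy2]|t x Vx].
- by rewrite !mulr0 !mul0r component0 mulr0 mul0r.
- by rewrite !mulrDl !mulrDr !componentD IHx1 IHx2 IHy1 IHy2 mulrDl mulrDr.
have [Vzx Vxz] := principal_gradedM R0z Vx.
rewrite (component_hom _ Vx) (component_hom _ Vzx) (component_hom _ Vxz).
by case: eqP; rewrite ?mulr0 ?mul0r.
Qed.

Lemma component_id_principal x e : R0 (component x (catid e)).
Proof.
exists (fun i => if i == e then component x (catid e) else 0).
apply: (@decomposition1 R (catob G) (fun e => V (catid e))) => [i|].
  exact: graded0.
exact: component_graded.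
Qed.

(** * Lists bounding the support, and their shrinking inside an ideal *)

Definition supported (S : seq (catmor G)) x :=
  forall s, s \notin S -> component x s = 0.

Lemma supported_neq0 S x s : supported S x -> component x s <> 0 -> s \in S.
Proof. by move=> xS; apply: contra_notT => /xS. Qed.

(** Commutation with [z] acts componentwise, so no new degree appears, and degree [catid e] vanishes
    because that component lies in $R_0$. [rem] deletes a single occurrence; a repeated one would be
    harmless, as the list only bounds the support. *)
Lemma supported_commutator S x z e :
  supported S x -> component x (catid e) <> 0 -> center_of R0 z ->
  exists2 S', (size S' < size S)%N & supported S' (z * x - x * z).
Proof.
move=> xS xe [R0z zC]; exists (rem (catid e) S).
  (* Membership of [catid e] makes [S] nonempty, so the removal strictly shortens it. *)
  have eS := supported_neq0 xS xe.
  by rewrite size_rem// prednK//; case: S eS {xS}.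
move=> s sS; rewrite componentB.
have [-> ->] := component_principalM x s R0z.
have [->|se] := eqVneq s (catid e).
  by rewrite zC ?subrr//; exact: component_id_principal.
rewrite xS ?mulr0 ?mul0r ?subrr//; apply: contra sS => sS.
by move: sS; rewrite (perm_mem (perm_to_rem (supported_neq0 xS xe))) inE
  (negbTE se).
Qed.

(** For $s$ in the support, nondegeneracy gives a homogeneous factor of degree $s^{-1}$ that does
    not kill $x_s$. The product has this nonzero element as its component at $ss^{-1}=c(s)$ in the
    right case, at $s^{-1}s=d(s)$ in the left one. Translating the list keeps its size. *)
Lemma supported_translate S x : is_groupoid G ->
  right_nondegenerate V \/ left_nondegenerate V -> x <> 0 -> supported S x ->
  exists y T e, [/\ (exists a, y = x * a \/ y = a * x),
    component y (catid e) <> 0, supported T y & size T = size S].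
Proof.
move=> HG Hnd x0 xS; have [s xs0] := component_neq0 x0.
have [s' ss'] := HG s; have [ds cs css' cs's] := ss'.
have Vxs := component_graded x s.
case: Hnd => /(_ _ _ ss' _ Vxs xs0) nd.
- have [y Vy xy] : exists2 y, V s' y & component x s * y <> 0.
    apply: contrapT => xy; apply: nd.
    apply/seteqP; split=> [_ [n [a [b [xa Vb ->]]]]|_ ->].
      apply: big1 => i _; rewrite xa.
      by apply: contrapT => ?; apply: xy; exists (b i).
    (* Zero is the empty sum, so the families over ['I_0] are arbitrary. *)
    by exists 0%N, (fun=> component x s), (fun=> 0); rewrite big_ord0;
      split=> // -[].
  exists (x * y), [seq catcomp t s' | t <- S], (catcod s).
  split; rewrite ?size_map//; first by exists y; left.
    by rewrite (component_mulr _ _ ss' Vy) catdom_id cs eqxx catcomp_idl.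
  move=> u uS; rewrite (component_mulr _ _ ss' Vy); case: eqP => // du.
  rewrite xS ?mul0r//; apply: contra uS => uS.
  (* The preimage of $u$ under the translation is $us$, as $u=(us)s^{-1}$. *)
  apply/mapP; exists (catcomp u s) => //.
  by rewrite -catcompA ?du// css' -cs -du catcomp_idr.
- have [y Vy xy] : exists2 y, V s' y & y * component x s <> 0.
    apply: contrapT => xy; apply: nd.
    apply/seteqP; split=> [_ [n [a [b [Va xb ->]]]]|_ ->].
      apply: big1 => i _; rewrite xb.
      by apply: contrapT => ?; apply: xy; exists (a i).
    by exists 0%N, (fun=> 0), (fun=> component x s); rewrite big_ord0;
      split=> // -[].
  exists (y * x), [seq catcomp s' t | t <- S], (catdom s).
  split; rewrite ?size_map//; first by exists y; right.
    by rewrite (component_mull _ _ ss' Vy) catcod_id ds eqxx -ds catcomp_idr.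
  move=> u uS; rewrite (component_mull _ _ ss' Vy); case: eqP => // du.
  rewrite xS ?mulr0//; apply: contra uS => uS.
  (* Likewise $u=s^{-1}(su)$. *)
  apply/mapP; exists (catcomp s u) => //.
  by rewrite catcompA ?du// cs's ds -du catcomp_idl.
Qed.

(** The induction is on a bound for the size of [S]: translation preserves this size and a nonzero
    commutator lowers it, so the process must stop at an element commuting with $Z(R_0)$. *)
Lemma supported_ideal_intersection I S x : is_groupoid G ->
  right_nondegenerate V \/ left_nondegenerate V -> two_sided_ideal I ->
  I x -> x <> 0 -> supported S x ->
  exists y, [/\ I y, y <> 0 & commutant [set: R] (center_of R0) y].
Proof.
move=> HG Hnd [/zmod_closed_set[_ IB _] IM].
have [n] := ubnP (size S); elim: n S x => // n IHn S x Sn Ix x0 xS.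
have [y [T [e [[a xya] ye yT TS]]]] := supported_translate HG Hnd x0 xS.
have Iy : I y by have [Iax Ixa] := IM a x Ix; case: xya => ->.
have [yC|yC] := pselect (commutant [set: R] (center_of R0) y).
  by exists y; split=> // y0; apply: ye; rewrite y0 component0.
have [z zC zy] : exists2 z, center_of R0 z & z * y - y * z <> 0.
  apply: contrapT => C; apply: yC; split=> // z zC; apply: contrapT => zy.
  by apply: C; exists z => // /subr0_eq /esym.
have [T' T'T zT'] := supported_commutator yT ye zC.
apply: IHn zy zT'; first by apply: leq_trans T'T _; rewrite TS.
by have [Izy Iyz] := IM z y Iy; exact: IB.
Qed.

End Components.

Theorem theorem3 (G : category) (HG : is_groupoid G) (R : nzRingType)
    (V : catmor G -> set R) (HV : is_graded V)
    (Hnd : right_nondegenerate V \/ left_nondegenerate V) :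
  ideal_intersection_property
    (commutant [set: R]%classic (center_of (principal_component V))).
Proof.
(* As [I] contains 0, differing from $\{0\}$ means having a nonzero element. *)
move=> I HI In0; have [x Ix x0] : exists2 x, I x & x <> 0.
  apply: contrapT => I0; apply: In0; apply/seteqP; split=> [x Ix|_ ->].
    by apply: contrapT => x0; apply: I0; exists x.
  by case: HI => /zmod_closed_set[].
have [S xS] := component_support HV x.
have [y [Iy y0 yC]] := supported_ideal_intersection HG Hnd HI Ix x0 xS.
by move/seteqP => [/(_ y (conj yC Iy))].
Qed.
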